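(* Let $D_n=(N,A)$ be the complete digraph on $n\ge 4$ nodes, let $c=(c_1,\dots,c_m)$ be a cardinality sequence, let $P^*=\{x\in P_C^{c}(D_n): x(\delta^{\mathrm{out}}(1))=1\}$, and let $W\subseteq N$ with $1\in W$ and $c_p<|W|<c_{p+1}$ for some $p\in\{1,\dots,m-1\}$. The cardinality-forcing inequality \[(c_{p+1}-|W|)\sum_{i\in W}x(\delta^{\mathrm{out}}(i))-(|W|-c_p)\sum_{i\in N\setminus W}x(\delta^{\mathrm{out}}(i))\le c_p(c_{p+1}-|W|)\] defines a facet of $P^*$ if and only if either ($c_{p+1}-|W|\ge 2$ and $c_{p+1}<n$) or ($c_{p+1}=n$ and $|W|=n-1$).
   Context: $D_n=(N,A)$ is the complete digraph with $N=\{1,\dots,n\}$, $A=\{(i,j):i\ne j\}$. A cardinality sequence is a sequence of integers $1\le c_1<\dots<c_m\le n$. $P_C^{c}(D_n)$ is the convex hull in $\mathbb{R}^A$ of incidence vectors of simple directed cycles of $D_n$ with number of arcs in $\{c_1,\dots,c_m\}$. For $F\subseteq A$, $x(F)=\sum_{(i,j)\in F}x_{ij}$; $\delta^{\mathrm{out}}(i)$ is the set of arcs leaving $i$.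
   Formalization: The formal theorem additionally assumes c_p ≥ 2: D_n has no cycle with one arc, and for c_p = 1 the claim fails (n = 4, c = (1,4), |W| = 3: every Hamiltonian cycle satisfies the inequality with equality, so the face is all of P* ). *)

(* Defs.v *)
From HB Require Import structures.
From mathcomp Require Import all_boot all_order all_algebra.

Set Implicit Arguments.
Unset Strict Implicit.
Unset Printing Implicit Defensive.

Import Order.TTheory GRing.Theory Num.Theory.

Local Open Scope ring_scope.

Section ConvexGeometry.

Variables (R : realFieldType) (V : lmodType R).

Definition conv_hull (S : V -> Prop) (x : V) : Prop :=
  exists (k : nat) (p : 'I_k -> V) (l : 'I_k -> R),
    [/\ forall i, S (p i), forall i, 0 <= l i, \sum_i l i = 1
      & x = \sum_i l i *: p i].

Definition affinely_independent (k : nat) (p : 'I_k -> V) : Prop :=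
  forall l : 'I_k -> R,
    \sum_i l i = 0 -> \sum_i l i *: p i = 0 -> forall i, l i = 0.

(* The affine dimension: [d + 1] is the maximal number of affinely
   independent points of [S]; in particular the empty set has dimension -1. *)
Definition has_dim (S : V -> Prop) (d : int) : Prop :=
  forall k : nat,
    (exists2 p : 'I_k -> V, forall i, S (p i) & affinely_independent p)
    <-> (k%:Z <= d + 1).

Definition defines_facet (P : V -> Prop) (f : V -> R) (b : R) : Prop :=
  (forall x, P x -> f x <= b) /\
  (exists2 d : int, has_dim P d & has_dim (fun x => P x /\ f x = b) (d - 1)).

End ConvexGeometry.

(* The complete digraph on the nodes 'I_n: node [i] of {1, ..., n} is the
   ordinal of value [i - 1]. *)
Notation arc n := {e : 'I_n * 'I_n | e.1 != e.2}.

(* The space R^A; [R^o] provides the vector space structure. *)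
Notation arcvec R n := {ffun arc n -> R^o}.

Definition node1 (n : nat) (hn : (4 <= n)%N) : 'I_n :=
  Ordinal (leq_trans (isT : (0 < 4)%N) hn).

(* The arcs joining cyclically consecutive nodes of [s]. *)
Definition cycle_arcs (n : nat) (s : seq 'I_n) : {set arc n} :=
  [set e : arc n | ((val e).1 \in s) && (next s (val e).1 == (val e).2)].

(* [ucycle] forces [s] to be duplicate-free, and the irreflexivity of the
   adjacency relation excludes sequences of length 1. *)
Definition is_dicycle (n : nat) (F : {set arc n}) : Prop :=
  exists s : seq 'I_n,
    [/\ s != [::], ucycle (fun i j => i != j) s & F = cycle_arcs s].

Definition incidence (R : realFieldType) (n : nat) (F : {set arc n}) :
  arcvec R n := [ffun e => (e \in F)%:R].

Definition cardinality_sequence (n : nat) (c : seq nat) : bool :=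
  sorted ltn c && all (fun k => 1 <= k <= n)%N c.

(* [c_ p] is numbered from 1. *)
Definition card_at (c : seq nat) (p : nat) : nat := nth 0%N c p.-1.

Definition PC (R : realFieldType) (n : nat) (c : seq nat) :
    arcvec R n -> Prop :=
  conv_hull (fun x : arcvec R n =>
    exists F : {set arc n},
      [/\ is_dicycle F, #|F| \in c & x = incidence R F]).

Definition arcsum (R : realFieldType) (n : nat) (x : arcvec R n)
  (F : {set arc n}) : R := \sum_(e in F) x e.

Definition delta_out (n : nat) (i : 'I_n) : {set arc n} :=
  [set e : arc n | (val e).1 == i].

Definition Pstar (R : realFieldType) (n : nat) (hn : (4 <= n)%N)
    (c : seq nat) (x : arcvec R n) : Prop :=
  PC c x /\ arcsum x (delta_out (node1 hn)) = 1.

(* Main.v *)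
(**
A cycle with [a] nodes in [W] and [b] outside satisfies the inequality, with
equality iff it is a [c_p]-cycle inside [W] or a [c_(p+1)]-cycle covering [W].
All points of P* lie on the hyperplane [x(delta_out 1) = 1], so that affine
dimension is linear dimension of the span, minus one.

Sufficiency is proved by duality. Let a linear functional [g] vanish on all tight
cycles. A signed sum of six tours on a common node set shows
[g(p,a) + g(q,b) = g(p,b) + g(q,a)], hence [g(i,j) = a_i + b_j], and the value of
[g] on a cycle is the sum of the node weights [a_i + b_i]. Exchanging nodes in
tight cycles shows that these weights are constant on [W \ 1] and outside [W], so
[g] is proportional to the slack of the inequality.

Necessity: if [c_(p+1) = |W| + 1 < n], the face also satisfies [x_uv = 0] for
[u, v] outside [W]; if [c_(p+1) = n] and [|W| <= n - 2], it also satisfies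
[x(delta_out u) = x(delta_out v)]. In both cases the codimension is at least two.
*)
Require Import Defs.
From HB Require Import structures.
From mathcomp Require Import all_boot all_order all_algebra.
From mathcomp Require Import ring lra zify.

Set Implicit Arguments.
Unset Strict Implicit.
Unset Printing Implicit Defensive.

Import Order.TTheory GRing.Theory Num.Theory.

Local Open Scope ring_scope.

(* [arc] now means path.arc, which shadows the arcs of Defs. *)
Local Notation dart n := (Defs.arc n).

(** * Affine dimension, faces and facets through linear spans *)

Section Dimension.

Variables (R : realFieldType) (V : vectType R).

Lemma has_dim_ext (S T : V -> Prop) (d : int) :
  (forall x, S x <-> T x) -> has_dim S d -> has_dim T d.
Proof.
move=> eST dS k; rewrite -(dS k).
by split=> -[p pS pI]; exists p => // i; apply/eST.
Qed.

Lemma defines_facet_ext (P : V -> Prop) (f g : V -> R) b :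
  f =1 g -> defines_facet P f b <-> defines_facet P g b.
Proof.
suff H f1 f2 : f1 =1 f2 -> defines_facet P f1 b -> defines_facet P f2 b.
  by move=> fg; split; apply: H => // x.
move=> fg [fP [d dP dF]]; split=> [x /fP|]; first by rewrite fg.
by exists d => //; apply: has_dim_ext dF => x; rewrite fg.
Qed.

(** [has_dim] counts points of the set itself, so a basis of the span has to be chosen among the
    given vectors. *)
Lemma free_subfamily (X : seq V) :
  exists Y : seq V, [/\ {subset Y <= X}, free Y & <<Y>>%VS = <<X>>%VS].
Proof.
elim: X => [|x X [Y [YX fY eYX]]]; first by exists [::]; rewrite nil_free.
have [xY|xNY] := boolP (x \in <<Y>>%VS).
  exists Y; split=> // [y /YX yX|]; first by rewrite inE yX orbT.
  by rewrite span_cons -eYX; apply/esym/addv_idPr; rewrite -memvE.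
exists (x :: Y); split; last by rewrite !span_cons eYX.
- by move=> y; rewrite !inE => /orP[->//|/YX ->]; rewrite orbT.
- by rewrite free_cons xNY.
Qed.

Lemma scalar_sum (h : {scalar V}) k (l : 'I_k -> R) (p : 'I_k -> V) :
  h (\sum_i l i *: p i) = \sum_i l i * h (p i).
Proof. by rewrite linear_sum; apply: eq_bigr => i _; rewrite linearZ. Qed.

Lemma scalar_span (f h : {scalar V}) b (Y : seq V) x :
  (forall y, y \in Y -> f y = b * h y) -> x \in <<Y>>%VS -> f x = b * h x.
Proof.
move=> fY /(@coord_span _ _ _ (in_tuple Y)) ex.
have [l ->] : exists l, x = \sum_(i < size Y) l i *: Y`_i.
  by exists (fun i => coord (in_tuple Y) i x).
rewrite !scalar_sum mulr_sumr.
apply: eq_bigr => i _; rewrite fY; first by ring.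
exact: mem_nth.
Qed.

(** Applying [h] to a vanishing combination of the [p i] shows that its coefficients sum to 0, so
    the affine side condition is automatic. *)
Lemma affinely_independent_free (h : {scalar V}) k (p : 'I_k -> V) :
  (forall i, h (p i) = 1) ->
  affinely_independent p <-> free [tuple p i | i < k].
Proof.
move=> hp; split=> [pI|/freeP pF l _ l0].
  apply/freeP => l; under eq_bigr do rewrite nth_mktuple.
  move=> l0; apply: pI => //.
  have := congr1 h l0; rewrite scalar_sum linear0 => hl.
  by rewrite -[RHS]hl; apply: eq_bigr => i _; rewrite hp mulr1.
by apply: pF; under eq_bigr do rewrite nth_mktuple.
Qed.

Lemma has_dim_span (h : {scalar V}) (S : V -> Prop) (X : seq V) :
    (forall x, S x -> h x = 1) -> (forall x, x \in X -> S x) ->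
    (forall x, S x -> x \in <<X>>%VS) ->
  has_dim S ((\dim <<X>>%VS)%:Z - 1).
Proof.
move=> hS XS SX k; rewrite subrK lez_nat; split=> [[p pS]|].
  move/(affinely_independent_free (fun i => hS _ (pS i))) => fp.
  have := fp; rewrite /free size_tuple => /eqP <-; apply: dimvS.
  by apply/span_subvP => _ /mapP[i _ ->]; apply: SX.
have [Y [YX fY <-]] := free_subfamily X.
move: (fY); rewrite /free => /eqP -> kY.
pose p (i : 'I_k) := nth 0 Y i.
have pS i : S (p i) by apply/XS/YX/mem_nth/(leq_trans (ltn_ord i)).
exists p => //; apply/(affinely_independent_free (fun i => hS _ (pS i))).
have -> : [tuple p i | i < k] = take k Y :> seq V.
  apply: (@eq_from_nth _ 0) => [|i]; rewrite size_tuple ?size_takel // => ik.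
  by rewrite -[i]/(val (Ordinal ik)) nth_mktuple nth_take.
by move: fY; rewrite -{1}(cat_take_drop k Y) => /catl_free.
Qed.

Lemma dim_span_cons (x : V) (Y : seq V) :
  x \notin <<Y>>%VS -> \dim <<x :: Y>>%VS = (\dim <<Y>>%VS).+1.
Proof.
have [Z [_ fZ eZ]] := free_subfamily Y; rewrite span_cons -eZ -span_cons => xZ.
have : free (x :: Z) by rewrite free_cons xZ.
by move: fZ; rewrite /free => /eqP-> /eqP->.
Qed.

(** The maps [f - b] and [g] kill every [p i]. Applied to an affine relation they leave a
    homogeneous 2 by 2 system in the coefficients of [y] and [z], with nonzero determinant. *)
Lemma affinely_independent_cons2 (f g : {scalar V}) b k (p : 'I_k -> V) y z :
    (forall i, f (p i) = b) -> (forall i, g (p i) = 0) ->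
    (f y - b) * g z != (f z - b) * g y ->
    affinely_independent p ->
  exists2 q : 'I_k.+2 -> V, affinely_independent q &
    forall i, q i = y \/ q i = z \/ exists j, q i = p j.
Proof.
move=> fp gp det pI.
pose q (i : 'I_k.+2) := if unlift ord0 i is Some j then
  if unlift ord0 j is Some m then p m else z else y.
exists q; last first.
  move=> i; rewrite /q; case: (unlift _ i) => [j|]; last by left.
  by case: (unlift _ j) => [m|]; right; [right; exists m | left].
move=> l; rewrite !big_ord_recl /q unlift_none liftK unlift_none.
under [X in _ -> _ + (_ + X) = 0 -> _]eq_bigr do rewrite !liftK.
set l0 := l ord0; set l1 := l (@lift k.+2 ord0 (@ord0 k)) => s0 v0.
pose s := \sum_(i < k) l (lift ord0 (lift ord0 i)).
have fv : l0 * f y + (l1 * f z + s * b) = 0.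
  have := congr1 f v0; rewrite !linearD scalar_sum linear0 !linearZ /=.
  by under eq_bigr do rewrite fp; rewrite -mulr_suml.
have gv : l0 * g y + l1 * g z = 0.
  have := congr1 g v0; rewrite !linearD scalar_sum linear0 !linearZ /=.
  by rewrite [X in _ + (_ + X)]big1 ?addr0 // => i _; rewrite gp mulr0.
have {}fv : l0 * (f y - b) + l1 * (f z - b) = 0.
  have es : s = - (l0 + l1).
    by apply/eqP; rewrite -subr_eq0 opprK -[X in _ == X]s0 /s; apply/eqP; ring.
  by rewrite -[RHS]fv es; ring.
have l00 : l0 = 0.
  have : l0 * ((f y - b) * g z - (f z - b) * g y) = 0.
    have -> : l0 * ((f y - b) * g z - (f z - b) * g y) =
      g z * (l0 * (f y - b) + l1 * (f z - b)) - (f z - b) * (l0 * g y + l1 * g z) by ring.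
    by rewrite fv gv !mulr0 subr0.
  by move/eqP; rewrite mulf_eq0 subr_eq0 (negbTE det) orbF => /eqP.
have l10 : l1 = 0.
  have : l1 * ((f y - b) * g z - (f z - b) * g y) = 0.
    have -> : l1 * ((f y - b) * g z - (f z - b) * g y) =
      (f y - b) * (l0 * g y + l1 * g z) - g y * (l0 * (f y - b) + l1 * (f z - b)) by ring.
    by rewrite fv gv !mulr0 subr0.
  by move/eqP; rewrite mulf_eq0 subr_eq0 (negbTE det) orbF => /eqP.
move: s0 v0; rewrite l00 l10 !scale0r !add0r => s0 v0.
have lp := pI _ s0 v0.
move=> i; have [j ->|->//] := unliftP ord0 i.
by have [m ->|->//] := unliftP ord0 j.
Qed.

(** The face lies in the two hyperplanes [f = b] and [g = 0], and [y], [z] witness that they are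
    independent on [P]; hence the codimension is at least two. *)
Lemma not_facet (f g : {scalar V}) b (P : V -> Prop) y z :
    (forall x, P x -> f x = b -> g x = 0) -> P y -> P z ->
    (f y - b) * g z != (f z - b) * g y ->
  ~ defines_facet P f b.
Proof.
move=> gF Py Pz det [_ [d dP dF]].
have d0 : 1%:Z <= d + 1.
  apply/dP; exists (fun=> y) => // l; rewrite big_ord1 => l0 _ i.
  by rewrite ord1.
have [k ek] : exists k : nat, d = k%:Z.
  by case: d d0 {dP dF} => [k|[]] // _; exists k.
(* The face holds [k = d] affinely independent points; adding [y] and [z] gives [k + 2] in [P], one
   more than [d + 1]. *)
have /dF[p pF pI] : k%:Z <= d - 1 + 1 by rewrite subrK ek.
have [q qI qP] := affinely_independent_cons2 (fun i => proj2 (pF i))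
  (fun i => gF _ (proj1 (pF i)) (proj2 (pF i))) det pI.
have /dP : exists2 q : 'I_k.+2 -> V, forall i, P (q i) & affinely_independent q.
  exists q => // i; have [->//|[->//|[j ->]]] := qP i; exact: (proj1 (pF j)).
by rewrite ek; lia.
Qed.

(** On the span of [Y] one has [f = b * h], so [y] lies outside it. The last hypothesis makes
    [y :: Y] span [P], so the two dimensions differ by exactly one. *)
Lemma facet_of_spans (h f : {scalar V}) b (P : V -> Prop) (X Y : seq V) y :
    (forall x, P x -> h x = 1) -> (forall x, P x -> f x <= b) ->
    (forall x, x \in X -> P x) -> (forall x, P x -> x \in <<X>>%VS) ->
    (forall x, x \in Y -> P x /\ f x = b) ->
    (forall x, P x -> f x = b -> x \in <<Y>>%VS) ->
    P y -> f y != b -> (forall x, x \in X -> x \in <<y :: Y>>%VS) ->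
  defines_facet P f b.
Proof.
move=> hP fP XP PX YP PY Py fy Xy; split=> //.
exists ((\dim <<X>>%VS)%:Z - 1); first exact: has_dim_span hP XP PX.
have yY : y \notin <<Y>>%VS.
  apply: contra_neqN fy => /(scalar_span (f := f) (h := h) (b := b)) ->.
    by rewrite hP // mulr1.
  by move=> x /YP[/hP -> ->]; rewrite mulr1.
have -> : (\dim <<X>>%VS)%:Z - 1 - 1 = (\dim <<Y>>%VS)%:Z - 1.
  have -> : \dim <<X>>%VS = (\dim <<Y>>%VS).+1.
    rewrite -(dim_span_cons yY); congr (\dim _).
    apply: subv_anti; apply/andP; split; apply/span_subvP => // x.
    by rewrite inE => /predU1P[->|/YP[]] *; apply: PX.
  lia.
apply: (has_dim_span (h := h)) => [x []|//|x []]; [by move=> /hP|exact: PY].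
Qed.

(** The weighted slacks [l i * (b - f (p i))] are nonnegative and sum to 0, so every generator with
    nonzero weight is tight. *)
Lemma conv_hull_face (f : {scalar V}) b (S : V -> Prop) (U : {vspace V}) x :
    (forall y, S y -> f y <= b) -> (forall y, S y -> f y = b -> y \in U) ->
  conv_hull S x -> f x = b -> x \in U.
Proof.
move=> fS SU [k [p [l [pS l0 l1 ->]]]]; rewrite scalar_sum => fl.
have : \sum_i l i * (b - f (p i)) = 0.
  under eq_bigr do rewrite mulrBr; rewrite sumrB fl -mulr_suml l1.
  by rewrite mul1r subrr.
have nn i : 0 <= l i * (b - f (p i)) by rewrite mulr_ge0 ?subr_ge0 ?fS.
move/eqP; rewrite psumr_eq0 => [/allP lf|i _ //].
apply: memv_suml => i _; have := lf i (mem_index_enum i).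
rewrite implyTb mulf_eq0 subr_eq0 => /orP[/eqP->|/eqP fi].
  by rewrite scale0r mem0v.
by rewrite memvZ // SU.
Qed.

Lemma conv_hull_le (f : {scalar V}) b (S : V -> Prop) x :
  (forall y, S y -> f y <= b) -> conv_hull S x -> f x <= b.
Proof.
move=> fS [k [p [l [pS l0 l1 ->]]]]; rewrite scalar_sum.
rewrite -[leRHS]mul1r -l1 mulr_suml; apply: ler_sum => i _.
by rewrite ler_wpM2l ?fS.
Qed.

Lemma conv_hull_point (S : V -> Prop) x : S x -> conv_hull S x.
Proof.
move=> Sx; exists 1%N, (fun=> x), (fun=> 1).
by rewrite !big_ord1 scale1r; split=> // i; rewrite ler01.
Qed.

End Dimension.

(** * Linear functionals on arc vectors and their values on cycles *)

Section Cycles.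

Variables (R : realFieldType) (n : nat).
Implicit Types (g : dart n -> R) (s : seq 'I_n) (i j : 'I_n).

Definition dot g (x : arcvec R n) : R := \sum_e g e * x e.

Fact dot_is_scalar g : scalar (dot g).
Proof.
move=> k x y; rewrite /dot mulr_sumr -big_split /=.
by apply: eq_bigr => e _; rewrite !ffunE /GRing.scale /=; ring.
Qed.

HB.instance Definition _ g :=
  GRing.isLinear.Build R (arcvec R n) R *%R (dot g) (dot_is_scalar g).

(** Double annihilator: each coordinate of the residual [x - projv U x] is a functional of [x] that
    vanishes on [Y], hence it is 0 at [x]. *)
Lemma mem_span_dot (Y : seq (arcvec R n)) (x : arcvec R n) :
    (forall g, (forall y, y \in Y -> dot g y = 0) -> dot g x = 0) ->
  x \in <<Y>>%VS.
Proof.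
set U := <<Y>>%VS => Yx; suff /eqP : x - projv U x = 0.
  by rewrite subr_eq0 => /eqP ->; apply: memv_proj.
apply/ffunP => e; rewrite [RHS]ffunE.
pose delta (e' : dart n) : arcvec R n := [ffun a => (a == e')%:R].
pose g (e' : dart n) : R := (delta e' - projv U (delta e')) e.
have dg v : dot g v = (v - projv U v) e.
  have {2 3}-> : v = \sum_e' v e' *: delta e'.
    apply/ffunP => a; rewrite sum_ffunE (bigD1 a) //= !ffunE eqxx /GRing.scale /= mulr1.
    rewrite big1 ?addr0 // => e' ne; rewrite !ffunE eq_sym (negbTE ne).
    by rewrite /GRing.scale /= mulr0.
  rewrite linear_sum -sumrB sum_ffunE; apply: eq_bigr => e' _.
  by rewrite linearZ -scalerBr /g !ffunE /GRing.scale /= mulrC.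
rewrite -dg Yx // => y yY; rewrite dg projv_id ?subrr ?ffunE //.
exact: memv_span.
Qed.

Lemma dot_incidence g (F : {set dart n}) :
  dot g (incidence R F) = \sum_(e in F) g e.
Proof.
rewrite /dot [RHS]big_mkcond /=; apply: eq_bigr => e _; rewrite ffunE.
by case: (e \in F); rewrite ?mulr1 ?mulr0.
Qed.

(** The default 0 on the diagonal gives a function of two arbitrary nodes, as the exchange arguments
    need. *)
Definition arc_ext g i j : R := oapp g 0 (insub (i, j)).

Lemma arc_extE g (e : dart n) : arc_ext g (val e).1 (val e).2 = g e.
Proof. by rewrite /arc_ext -surjective_pairing valK. Qed.

Lemma ucycle_neq s : uniq s -> (1 < size s)%N -> ucycle (fun i j => i != j) s.
Proof.
case: s => [|x [|y s]] // Us _; rewrite /ucycle Us andbT /=.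
move: Us; rewrite /= inE negb_or => /andP[/andP[xy xs] /andP[ys Us]].
rewrite xy rcons_path -[path _ _ _]/(sorted _ (y :: s)) pairwise_sorted /=; last first.
  by rewrite -uniq_pairwise Us andbT; apply/allP => z zs; apply: contraNneq ys => ->.
apply: contraNneq xs => /= e; move: (mem_last y s).
by rewrite e inE (negbTE xy).
Qed.

Lemma sum_cycle_arcs g s : ucycle (fun i j => i != j) s ->
  \sum_(e in cycle_arcs s) g e = \sum_(i <- s) arc_ext g i (next s i).
Proof.
case/andP=> cs Us; rewrite (partition_big (fun e : dart n => (val e).1) predT) //=.
rewrite [RHS]big_uniq //= [RHS]big_mkcond /=; apply: eq_bigr => i _.
case: ifP => [si|si]; last first.
  rewrite big1 // => e; rewrite inE => /andP[/andP[es _] /eqP ei].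
  by rewrite -ei es in si.
have ne := next_cycle cs si.
pose e0 : dart n := exist (fun e : 'I_n * 'I_n => e.1 != e.2) (i, next s i) ne.
rewrite (big_pred1 e0) => [|e]; first by rewrite -arc_extE.
rewrite inE /= -[_ == e0]val_eqE; case: e => -[u v] uv /=; rewrite xpair_eqE andbC.
by case: eqP => //= ->; rewrite si eq_sym.
Qed.

(** Cutting the cycle open at [x] gives a form that computes on explicit node lists. *)
Lemma sum_next_pairmap (G : 'I_n -> 'I_n -> R) x (t : seq 'I_n) : uniq (x :: t) ->
  \sum_(i <- x :: t) G i (next (x :: t) i) =
  \sum_(v <- pairmap G x (rcons t x)) v.
Proof.
move=> Us; rewrite (big_nth x) [RHS](big_nth 0) size_pairmap size_rcons.
rewrite !big_nat; apply: eq_bigr => k /andP[_]; rewrite -[size _]/(size t).+1 => kt.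
rewrite (nth_pairmap x) ?size_rcons // next_nth mem_nth // index_uniq //.
congr G.
  by case: k kt => //= k kt; rewrite nth_rcons -ltnS kt.
rewrite nth_rcons; case: (ltnP k (size t)) => // tk.
by rewrite nth_default ?if_same.
Qed.

Lemma sum_next (b : 'I_n -> R) s : uniq s ->
  \sum_(i <- s) b (next s i) = \sum_(i <- s) b i.
Proof.
move=> Us; rewrite -(big_map (next s) xpredT b); apply: perm_big.
have Um : uniq (map (next s) s).
  by rewrite map_inj_uniq //; apply: can_inj (prev_next Us).
apply: uniq_perm => //.
apply: (uniq_min_size Um _ _).2; last by rewrite size_map.
by move=> _ /mapP[i si ->]; rewrite mem_next.
Qed.

(** Each node of a cycle is the tail of one arc and the head of one, so a tail potential plus a head
    potential sees only the node set. *)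
Lemma dot_cycle g (a b : 'I_n -> R) s : uniq s -> (1 < size s)%N ->
    (forall e, g e = a (val e).1 + b (val e).2) ->
  dot g (incidence R (cycle_arcs s)) = \sum_(i <- s) (a i + b i).
Proof.
move=> Us s1 gab; rewrite dot_incidence sum_cycle_arcs; last exact: ucycle_neq.
rewrite big_split /= -(sum_next b Us) -big_split /= big_seq [RHS]big_seq.
apply: eq_bigr => i si.
have /andP[cs _] := ucycle_neq Us s1; have ne := next_cycle cs si.
pose e0 : dart n := exist (fun e : 'I_n * 'I_n => e.1 != e.2) (i, next s i) ne.
by rewrite -[i in LHS]/((val e0).1) -[next s _ in LHS]/((val e0).2) arc_extE gab.
Qed.

Lemma card_cycle_arcs s : uniq s -> (1 < size s)%N -> #|cycle_arcs s| = size s.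
Proof.
move=> Us s1; apply/eqP; rewrite -(eqr_nat R); apply/eqP.
have := dot_cycle (g := fun=> 1) (a := fun=> 1) (b := fun=> 0) Us s1.
rewrite dot_incidence !sumr_const => ->; last by move=> e; rewrite addr0.
by rewrite addr0 big_const_seq count_predT iter_addr_0.
Qed.

End Cycles.

(** * Exchange arguments for node weights and arc weights *)

Section Exchange.

Lemma set_between (I : finType) (T U : {set I}) m :
    T \subset U -> (#|T| <= m <= #|U|)%N ->
  exists2 K : {set I}, (T \subset K) && (K \subset U) & #|K| = m.
Proof.
move=> TU /andP[Tm mU]; elim: m Tm mU => [|m IH] Tm mU.
  by exists T; rewrite ?subxx //; apply/eqP; rewrite -leqn0.
move: Tm; rewrite leq_eqVlt => /predU1P[<-|]; first by exists T; rewrite ?subxx.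
rewrite ltnS => Tm; have [K /andP[TK KU] cK] := IH Tm (ltnW mU).
have /properP[_ [x xU xK]] : K \proper U by rewrite properEcard KU cK.
exists (x |: K); last by rewrite cardsU1 xK cK.
by rewrite subUset sub1set xU KU (subset_trans TK) // subsetUr.
Qed.

(** Take [m - 1] elements containing [T] and avoiding [i] and [j]; completing them by [i] or by [j]
    gives two vanishing sums. *)
Lemma eq_of_subset_sums (R : realFieldType) (I : finType) (al : I -> R)
    (T U : {set I}) m :
    T \subset U -> (#|T| < m < #|U|)%N ->
    (forall K : {set I}, T \subset K -> K \subset U -> #|K| = m ->
      \sum_(i in K) al i = 0) ->
  forall i j, i \in U :\: T -> j \in U :\: T -> al i = al j.
Proof.
move=> TU Tm H i j; have [->//|ij] := eqVneq i j.
rewrite !inE => /andP[iT iU] /andP[jT jU].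
have sub2 : [set i; j] \subset U by rewrite subUset !sub1set iU.
have [||K /andP[TK KU] cK] := @set_between _ T (U :\: [set i; j]) m.-1.
- rewrite subsetD TU /= disjoint_sym disjoints_subset subUset !sub1set !inE.
  by rewrite iT jT.
- by have := cardsDS sub2; rewrite cards2 ij => ->; lia.
have [KsU iK jK] : [/\ K \subset U, i \notin K & j \notin K].
  split; first by apply: subset_trans KU _; apply: subsetDl.
    by apply/negP => /(subsetP KU); rewrite !inE eqxx.
  by apply/negP => /(subsetP KU); rewrite !inE eqxx orbT.
have Hx x : x \in U -> x \notin K -> al x = - \sum_(y in K) al y.
  move=> xU xK; apply/eqP; rewrite -subr_eq0 opprK -(big_setU1 _ xK) /=.
  have m0 : (0 < m)%N by case/andP: Tm => /(leq_ltn_trans (leq0n _)).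
  rewrite H // ?cardsU1 ?xK ?cK; last by rewrite add1n prednK.
    by apply: subset_trans TK _; apply: subsetUr.
  by rewrite subUset sub1set xU.
by rewrite !Hx.
Qed.

Variables (R : realFieldType) (n : nat).

(* The six cyclic orders of [p], [q], [a] and the path [b :: r], with signs:
   [(paqb) + (qpab) + (apqb) - (qapb) - (aqpb) - (pqab)] equals
   [2 (pa + qb - pb - qa)]. *)
Lemma quad_of_tours (G : 'I_n -> 'I_n -> R) p q a b r :
    uniq [:: p, q, a, b & r] ->
    (forall s, perm_eq s [:: p, q, a, b & r] ->
      \sum_(i <- s) G i (next s i) = 0) ->
  G p a + G q b = G p b + G q a.
Proof.
move=> Us H.
have tour x y z : perm_eq [:: x, y, z, b & r] [:: p, q, a, b & r] ->
    G x y + G y z + G z b + \sum_(v <- pairmap G b r) v + G (last b r) x = 0.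
  move=> ps; rewrite -[RHS](H _ ps) sum_next_pairmap ?(perm_uniq ps) //.
  by rewrite !rcons_cons -cats1 /= pairmap_cat !big_cons big_cat /= big_seq1; ring.
(* Permutations are tested by counting predicates; only the three leading nodes move, so eight
   Boolean cases settle each order. *)
have pm x y z : (forall P : pred 'I_n, (P x + P y + P z = P p + P q + P a)%N) ->
    perm_eq [:: x, y, z, b & r] [:: p, q, a, b & r].
  by move=> e; apply/permP => P /=; rewrite !addnA e.
have /tour T1 : perm_eq [:: p, a, q, b & r] [:: p, q, a, b & r].
  by apply: pm => P; case: (P p) (P q) (P a) => [] [] [].
have /tour T2 : perm_eq [:: q, p, a, b & r] [:: p, q, a, b & r].
  by apply: pm => P; case: (P p) (P q) (P a) => [] [] [].
have /tour T3 : perm_eq [:: a, p, q, b & r] [:: p, q, a, b & r].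
  by apply: pm => P; case: (P p) (P q) (P a) => [] [] [].
have /tour T4 : perm_eq [:: q, a, p, b & r] [:: p, q, a, b & r].
  by apply: pm => P; case: (P p) (P q) (P a) => [] [] [].
have /tour T5 : perm_eq [:: a, q, p, b & r] [:: p, q, a, b & r].
  by apply: pm => P; case: (P p) (P q) (P a) => [] [] [].
have /tour T6 : perm_eq [:: p, q, a, b & r] [:: p, q, a, b & r].
  by apply: pm => P; case: (P p) (P q) (P a) => [] [] [].
lra.
Qed.

(** Off column [o], each row of [G] differs from row [o] by a constant, which is [a i]. The
    reference nodes [o] and [j0 i] lie in [W], so that at most two nodes of a quadruple are
    outside. *)
Lemma additive_of_quads (G : 'I_n -> 'I_n -> R) (W : {set 'I_n}) o :
    (4 <= n)%N -> o \in W -> (3 <= #|W|)%N ->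
    (forall p q a b, uniq [:: p; q; a; b] ->
      (count (fun x => x \notin W) [:: p; q; a; b] <= 2)%N ->
      G p a + G q b = G p b + G q a) ->
  exists a b : 'I_n -> R, forall i j, i != j -> G i j = a i + b j.
Proof.
move=> n4 oW W3 Q.
have j0P i : exists j, [&& j \in W, j != o & j != i].
  have : (0 < #|W :\: [set o; i]|)%N.
    rewrite cardsD; have := subset_leq_card (subsetIr W [set o; i]).
    by rewrite cards2; lia.
  case/card_gt0P => j; rewrite !inE negb_or => /andP[/andP[jo ji] jW].
  by exists j; rewrite jW jo ji.
pose j0 i := xchoose (j0P i); pose i1 := j0 o.
have j0W i : j0 i \in W by case/and3P: (xchooseP (j0P i)).
have j0o i : j0 i != o by case/and3P: (xchooseP (j0P i)).
have j0i i : j0 i != i by case/and3P: (xchooseP (j0P i)).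
pose a i := if i == o then 0 else G i (j0 i) - G o (j0 i).
(* Row [o] has no arc into [o], so column [o] is calibrated on row [i1]. *)
pose b j := if j == o then G i1 o - a i1 else G o j.
have rows i j : i != o -> j != o -> j != i -> G i j = a i + G o j.
  move=> io jo ji; rewrite /a (negbTE io).
  have [->|jj] := eqVneq j (j0 i); first by ring.
  have := Q o i j (j0 i); rewrite /= oW j0W !inE !negb_or.
  rewrite ![o == _]eq_sym io jo j0o ![i == _]eq_sym ji j0i jj /=.
  move=> /(_ isT) H; have {H} : G o j + G i (j0 i) = G o (j0 i) + G i j.
    by apply: H; case: (i \in W); case: (j \in W).
  lra.
have i1W : i1 \in W := j0W o.
have i1o : i1 != o := j0o o.
exists a, b => i j; rewrite eq_sym => ji; rewrite /b.
have [ejo|jo] := eqVneq j o; last first.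
  have [eio|io] := eqVneq i o; last exact: rows.
  by rewrite eio /a eqxx add0r.
have io : i != o by rewrite -ejo eq_sym.
have [->|ii1] := eqVneq i i1; first by rewrite ejo; ring.
(* A fourth node, available as [4 <= n], serves to compare rows [i] and [i1] in column [o]. *)
have [j' /and3P[j'o j'i j'i1]] : exists j', [&& j' != o, j' != i & j' != i1].
  have : (0 < #|~: [set o; i; i1]|)%N.
    have := cardsC [set o; i; i1]; rewrite card_ord.
    have [+ _] := leq_card_setU [set o; i] [set i1]; rewrite cards1 cards2; lia.
  case/card_gt0P => j'; rewrite !inE !negb_or -andbA => H; by exists j'.
have := Q i i1 o j'; rewrite /= oW i1W !inE !negb_or.
rewrite ii1 io i1o ![_ == j']eq_sym j'o j'i j'i1 /=.
move=> /(_ isT) H; have {H} : G i o + G i1 j' = G i j' + G i1 o.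
  by apply: H; case: (i \in W); case: (j' \in W).
by rewrite ejo (rows i j') // (rows i1 j') //; lra.
Qed.

End Exchange.

(** * Functionals vanishing on the tight cycles *)

Section TightFunctional.

Variables (R : realFieldType) (n : nat).
Implicit Types (g : dart n -> R) (W : {set 'I_n}) (s : seq 'I_n).

Local Notation inc s := (incidence R (cycle_arcs s)).

Lemma sum_count (P : pred 'I_n) s :
  \sum_(i <- s) (P i)%:R = (count P s)%:R :> R.
Proof. by elim: s => [|x s IH]; rewrite ?big_nil // big_cons IH /= natrD. Qed.

Lemma count_superset W s : uniq s -> {subset W <= s} -> count (mem W) s = #|W|.
Proof.
move=> Us Ws; rewrite -size_filter cardE; apply/perm_size/uniq_perm.
- exact: filter_uniq.
- exact: enum_uniq.
by move=> x; rewrite mem_filter mem_enum /=; case: (boolP (x \in W)) => //= /Ws.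
Qed.

Lemma count_le_card W s : uniq s -> (count (mem W) s <= #|W|)%N.
Proof.
move=> Us; rewrite -size_filter cardE; apply: uniq_leq_size.
  exact: filter_uniq.
by move=> x; rewrite mem_filter mem_enum => /andP[].
Qed.

(** [W] and the quadruple fit into a set of [l] nodes, since at most two of the four lie outside [W]
    or since [l = n]. Every tour of that set covers [W], so the six-tour identity applies. *)
Lemma quads_of_tight g W l :
    (#|W| < l <= n)%N -> (#|W| + 2 <= l)%N || (l == n) ->
    (forall s, uniq s -> size s = l -> {subset W <= s} -> dot g (inc s) = 0) ->
  forall p q a b, uniq [:: p; q; a; b] ->
    (count (fun x => x \notin W) [:: p; q; a; b] <= 2)%N ->
    arc_ext g p a + arc_ext g q b = arc_ext g p b + arc_ext g q a.
Proof.
move=> /andP[Wl ln] lW tight p q a b; set L := [:: p; q; a; b] => UL cL.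
have [||S /andP[TS _] cS] := @set_between _ (W :|: [set x in L]) setT l.
- exact: subsetT.
- rewrite cardsT card_ord ln andbT.
  case/orP: lW => [lW|/eqP->]; last by rewrite -[n in (_ <= n)%N]card_ord max_card.
  have -> : W :|: [set x in L] = W :|: [set x in [seq x <- L | x \notin W]].
    by apply/setP => x; rewrite !in_setU !in_set mem_filter; case: (x \in W).
  have [+ _] := leq_card_setU W [set x in [seq x <- L | x \notin W]].
  have : (#|[set x in [seq x <- L | x \notin W]]| <= 2)%N.
    by rewrite cardsE (leq_trans (card_size _)) // size_filter.
  by move=> F2 /leq_trans; apply; apply: leq_trans lW; rewrite leq_add2l.
pose r := enum (S :\: [set x in L]).
have US : uniq (L ++ r).
  rewrite cat_uniq UL enum_uniq andbT /=; apply/hasPn => x.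
  by rewrite mem_enum in_setD in_set => /andP[].
have pS : perm_eq (L ++ r) (enum S).
  apply: uniq_perm => //; first exact: enum_uniq.
  move=> x; rewrite mem_cat !mem_enum in_setD in_set.
  case: (boolP (x \in L)) => //= xL; symmetry; apply: (subsetP TS).
  by rewrite in_setU in_set xL orbT.
apply: (@quad_of_tours R n (arc_ext g) p q a b r) => // s ps.
have {}ps : perm_eq s (enum S) by apply: perm_trans pS.
have Us : uniq s by rewrite (perm_uniq ps) enum_uniq.
have sS : size s = l by rewrite (perm_size ps) -cardE.
rewrite -sum_cycle_arcs -?dot_incidence; last first.
  apply: ucycle_neq => //; rewrite (perm_size ps) -(perm_size pS) /=; lia.
apply: tight => // x xW; rewrite (perm_mem ps) mem_enum (subsetP TS) //.
by rewrite in_setU xW.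
Qed.

(** The factor of [A] is the left side minus the right side of the cardinality-forcing inequality on
    a cycle. The two tight classes fix all node weights up to the single parameter [A]; the factor
    [l - #|W|] avoids a division. *)
Lemma tight_functional g W o k l :
    (4 <= n)%N -> o \in W -> (1 < k < #|W|)%N -> (#|W| < l <= n)%N ->
    ((2 <= l - #|W|)%N /\ (l < n)%N) \/ (l = n /\ #|W| = n.-1) ->
    (forall s, uniq s -> size s = k -> o \in s -> {subset s <= W} ->
      dot g (inc s) = 0) ->
    (forall s, uniq s -> size s = l -> {subset W <= s} -> dot g (inc s) = 0) ->
  exists A : R, forall s, uniq s -> (1 < size s)%N -> o \in s ->
    (l%:R - #|W|%:R) * dot g (inc s) =
    A * ((l%:R - #|W|%:R) * (count (mem W) s)%:R
         - (#|W|%:R - k%:R) * (count (mem (~: W)) s)%:R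
         - k%:R * (l%:R - #|W|%:R)).
Proof.
move=> n4 oW kW Wl lW tightk tightl.
have Q : forall p q a b, uniq [:: p; q; a; b] ->
    (count (fun x => x \notin W) [:: p; q; a; b] <= 2)%N ->
    arc_ext g p a + arc_ext g q b = arc_ext g p b + arc_ext g q a.
  apply: quads_of_tight tightl => //.
  by case: lW => [[lW _]|[-> _]]; rewrite ?eqxx ?orbT //; apply/orP; left; lia.
have [|a [b Gab]] := additive_of_quads n4 oW _ Q; first by lia.
have val_dot s : uniq s -> (1 < size s)%N -> dot g (inc s) = \sum_(i <- s) (a i + b i).
  move=> Us s1; apply: dot_cycle => // e; rewrite -Gab ?arc_extE //; exact: valP e.
pose al i := a i + b i.
have sum_k (K : {set 'I_n}) : [set o] \subset K -> K \subset W -> #|K| = k ->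
    \sum_(i in K) al i = 0.
  rewrite sub1set => oK /subsetP KW cK.
  rewrite -big_enum -val_dot ?enum_uniq -?cardE ?cK //; last by lia.
  apply: tightk; rewrite ?enum_uniq -?cardE ?cK ?mem_enum //.
  by move=> x; rewrite mem_enum => /KW.
have sum_l (K : {set 'I_n}) : W \subset K -> K \subset setT -> #|K| = l ->
    \sum_(i in K) al i = 0.
  move=> /subsetP KW _ cK.
  rewrite -big_enum -val_dot ?enum_uniq -?cardE ?cK //; last by lia.
  apply: tightl; rewrite ?enum_uniq -?cardE ?cK //.
  by move=> x; rewrite mem_enum => /KW.
have alW : forall i j, i \in W :\: [set o] -> j \in W :\: [set o] -> al i = al j.
  by apply: eq_of_subset_sums sum_k; rewrite ?sub1set ?cards1.
have alO i j : i \notin W -> j \notin W -> al i = al j.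
  (* For [l < n] the [l]-sets containing [W] permit exchanges outside [W]; otherwise [W] misses a
     single node. *)
  move=> iW jW; case: lW => [[lW ln]|[ln Wn]].
    apply: (eq_of_subset_sums (subsetT W) _ sum_l); rewrite ?inE ?iW ?jW //.
    by rewrite cardsT card_ord; lia.
  have : #|~: W| == 1%N by have := cardsC W; rewrite card_ord; lia.
  case/cards1P => u eu; suff /(_ _ _)/set1P E : forall x, x \notin W -> x \in [set u].
    by rewrite (E i iW) (E j jW).
  by move=> x xW; rewrite -eu inE.
have [i0 i0W] : exists i, i \in W :\: [set o].
  by apply/card_gt0P; have := cardsD1 o W; rewrite oW; lia.
have [u uW] : exists i, i \in ~: W.
  by apply/card_gt0P; have := cardsC W; rewrite card_ord; lia.
rewrite inE in uW.
pose A := al i0; pose B := al u; exists A.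
(* The node [o] keeps a weight of its own: it lies on every tight cycle considered and is never
   exchanged. *)
have alE i : al i = (al o - A) * (pred1 o i)%:R + A * (mem W i)%:R + B * (mem (~: W) i)%:R.
  rewrite /= inE; have [->|io] := eqVneq i o; first by rewrite oW /=; ring.
  case: (boolP (i \in W)) => /= iW; last by rewrite (alO i u) // /B; ring.
  have {}iW : i \in W :\: [set o] by rewrite !inE io.
  by rewrite (alW i i0) // /A; ring.
have vs s : uniq s -> o \in s -> \sum_(i <- s) al i =
    (al o - A) + A * (count (mem W) s)%:R + B * (count (mem (~: W)) s)%:R.
  move=> Us os; under eq_bigr do rewrite alE.
  by rewrite !big_split /= -!mulr_sumr !sum_count count_uniq_mem // os mulr1.
(* One [k]-set inside [W] fixes the weight of [o], and one [l]-set containing [W] then fixes [B],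
   both in terms of [A]. *)
have ek : al o - A = - (A * k%:R).
  have [||K /andP[oK KW] cK] := @set_between _ [set o] W k;
    rewrite ?sub1set ?cards1 //; first by lia.
  have := sum_k K oK KW cK; rewrite -big_enum vs ?enum_uniq ?mem_enum -?sub1set //.
  have cW : count (mem W) (enum K) = k.
    rewrite -cK cardE; apply/eqP; rewrite -all_count; apply/allP => x.
    by rewrite mem_enum => /(subsetP KW).
  have := count_predC (mem W) (enum K); rewrite cW -cardE cK.
  rewrite -[RHS]addn0 => /addnI.
  have -> : count (predC (mem W)) (enum K) = count (mem (~: W)) (enum K).
    by apply: eq_count => x; rewrite /= inE.
  by move=> ->; lra.
have el : (l%:R - #|W|%:R) * B = A * k%:R - A * #|W|%:R.
  have [||K /andP[WK _] cK] := @set_between _ W setT l;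
    rewrite ?subsetT ?cardsT ?card_ord //; first by lia.
  have := sum_l K WK (subsetT _) cK; rewrite -big_enum vs ?enum_uniq ?mem_enum ?(subsetP WK) //.
  have cW : count (mem W) (enum K) = #|W|.
    by apply: count_superset; rewrite ?enum_uniq // => x; rewrite mem_enum => /(subsetP WK).
  have := count_predC (mem W) (enum K); rewrite cW -cardE cK.
  have -> : count (predC (mem W)) (enum K) = count (mem (~: W)) (enum K).
    by apply: eq_count => x; rewrite /= inE.
  by move=> <-; rewrite ek natrD; lra.
move=> s Us s1 os; rewrite val_dot // -/(al _) vs // ek mulrDr [_ * (B * _)]mulrA el.
ring.
Qed.

End TightFunctional.

(** * Cycle vectors as generators of the polytope *)

Section CycleVectors.

Variables (R : realFieldType) (n : nat).
Implicit Types (x : arcvec R n) (W : {set 'I_n}) (s : seq 'I_n).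

Local Notation inc s := (incidence R (cycle_arcs s)).

Lemma dot_out (v : 'I_n -> R) s : uniq s -> (1 < size s)%N ->
  dot (fun e => v (val e).1) (inc s) = \sum_(i <- s) v i.
Proof.
move=> Us s1; rewrite (dot_cycle (a := v) (b := fun=> 0)) // => [|e].
  by under eq_bigr do rewrite addr0.
by rewrite addr0.
Qed.

Lemma sum_arcsum W x : \sum_(i in W) arcsum x (delta_out i) =
  dot (fun e => ((val e).1 \in W)%:R) x.
Proof.
rewrite /dot; under [RHS]eq_bigr do rewrite mulr_natl mulrb.
rewrite -big_mkcond (partition_big (fun e : dart n => (val e).1) (mem W)) //=.
apply: eq_bigr => i iW; apply: eq_bigl => e; rewrite inE.
by case: eqP => [->|]; rewrite ?iW ?andbF.
Qed.

Lemma arcsum_delta_out x i :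
  arcsum x (delta_out i) = dot (fun e => (pred1 i (val e).1)%:R) x.
Proof.
have := sum_arcsum [set i] x; rewrite big_set1 => ->.
by apply: eq_bigr => e _; rewrite inE.
Qed.

Definition cycle_vector (c : seq nat) x : Prop :=
  exists s, [/\ uniq s, (1 < size s)%N, size s \in c & x = inc s].

Lemma cycle_vectorP c x : cycle_vector c x <->
  exists F : {set dart n}, [/\ is_dicycle F, #|F| \in c & x = incidence R F].
Proof.
split=> [[s [Us s1 sc ->]]|[F [[s [s0 us ->]]]]].
  exists (cycle_arcs s); rewrite (card_cycle_arcs R) //; split=> //.
  by exists s; split; [by rewrite -size_eq0 -lt0n ltnW|exact: ucycle_neq|].
have Us : uniq s by case/andP: us.
have s1 : (1 < size s)%N.
  by case: s s0 us {Us} => [|y [|]] //; rewrite /ucycle /= eqxx.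
by rewrite (card_cycle_arcs R) // => sc ->; exists s.
Qed.

Lemma conv_hull_ext (S T : arcvec R n -> Prop) x :
  (forall y, S y <-> T y) -> conv_hull S x -> conv_hull T x.
Proof.
move=> ST [k [p [l [pS l0 l1 ->]]]]; exists k, p, l; split=> // i.
exact/ST.
Qed.

Lemma PCE c x : PC c x <-> conv_hull (cycle_vector c) x.
Proof.
by split; apply: conv_hull_ext => y; rewrite cycle_vectorP.
Qed.

(** Bounded sequences make this a finite list, whose span is available as a subspace. *)
Definition cycle_vectors_at (c : seq nat) (o : 'I_n) : seq (arcvec R n) :=
  [seq inc (val s) | s : n.-bseq 'I_n in
    [pred s : n.-bseq 'I_n | [&& uniq s, (1 < size s)%N, size s \in c & o \in val s]]].

Lemma mem_cycle_vectors_at c o x : reflect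
  (exists s, [/\ uniq s, (1 < size s)%N, size s \in c, o \in s & x = inc s])
  (x \in cycle_vectors_at c o).
Proof.
apply: (iffP mapP) => [[s + ->]|[s [Us s1 sc os ->]]].
  by rewrite mem_enum => /and4P[*]; exists s.
have sn : (size s <= n)%N.
  rewrite -[X in (_ <= X)%N]size_enum_ord.
  by apply: uniq_leq_size => // i _; rewrite mem_enum.
exists (Bseq sn) => //; rewrite mem_enum; exact/and4P.
Qed.

End CycleVectors.

(** Here [a] and [b] count the nodes of a cycle inside and outside a set of size [w]. A short cycle
    has [a <= k]; a long one must replace each missed node of the set by one outside, which only
    adds slack. *)
Lemma cardinality_forcing_nat k w l a b :
    (k < w < l)%N -> (a <= w)%N -> (a + b <= k)%N || (l <= a + b)%N ->
  ((l - w) * a <= k * (l - w) + (w - k) * b)%N /\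
  ((l - w) * a = k * (l - w) + (w - k) * b ->
    a = k /\ b = 0 \/ a = w /\ b = l - w)%N.
Proof.
case/andP=> kw wl aw; have [dk ek] : exists dk, w = (k + dk.+1)%N by exists (w - k).-1; lia.
have [dl el] : exists dl, l = (w + dl.+1)%N by exists (l - w).-1; lia.
have -> : (l - w = dl.+1)%N by lia.
have -> : (w - k = dk.+1)%N by lia.
case/orP=> ab; first by split; nia.
(* With [e] missed nodes and excess length [t] over [l], the slack is
   [(l - k) * e + (w - k) * t]. *)
have [e ee] : exists e, w = (a + e)%N by exists (w - a)%N; lia.
have [t et] : exists t, b = (dl.+1 + e + t)%N by exists (b - (dl.+1 + e))%N; lia.
by subst b; split; nia.
Qed.

Lemma sorted_ltn_gap (c : seq nat) i m : sorted ltn c -> (i.+1 < size c)%N ->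
  m \in c -> (m <= nth 0 c i)%N || (nth 0 c i.+1 <= m)%N.
Proof.
move=> sc ic /(nthP 0%N)[j jc <-].
have mono := sorted_leq_nth leq_trans leqnn 0%N (sub_sorted (fun x y => @ltnW x y) sc).
case: (leqP j i) => ji; apply/orP; [left|right]; apply: mono => //; rewrite inE //; lia.
Qed.

(** * The cardinality-forcing inequality on [Pstar] *)

Section CardinalityForcing.

Variables (R : realFieldType) (n : nat) (hn : (4 <= n)%N) (c : seq nat).
Variables (k l : nat) (W : {set 'I_n}).
Hypotheses (kc : k \in c) (lc : l \in c).
Hypothesis gap : forall m, m \in c -> (m <= k)%N || (l <= m)%N.
Hypotheses (k2 : (1 < k)%N) (kWl : (k < #|W| < l)%N) (ln : (l <= n)%N).

Local Notation o := (node1 hn).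
Local Notation inc s := (incidence R (cycle_arcs s)).

Hypothesis oW : o \in W.

Fact l_gt3 : (3 < l)%N.
Proof. lia. Qed.

Definition cf_coef (e : dart n) : R :=
  (l%:R - #|W|%:R) * ((val e).1 \in W)%:R
  - (#|W|%:R - k%:R) * ((val e).1 \in ~: W)%:R.

Definition cf_rhs : R := k%:R * (l%:R - #|W|%:R).

Let h (e : dart n) : R := (pred1 o (val e).1)%:R.

Lemma cf_coefE x : (l%:R - #|W|%:R) * (\sum_(i in W) arcsum x (delta_out i))
    - (#|W|%:R - k%:R) * (\sum_(i in ~: W) arcsum x (delta_out i))
  = dot cf_coef x.
Proof.
rewrite !sum_arcsum /dot !mulr_sumr -sumrB; apply: eq_bigr => e _.
by rewrite /cf_coef; ring.
Qed.

Lemma cf_cycle s : uniq s -> (1 < size s)%N -> dot cf_coef (inc s) =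
  (l%:R - #|W|%:R) * (count (mem W) s)%:R
  - (#|W|%:R - k%:R) * (count (mem (~: W)) s)%:R.
Proof.
move=> Us s1; rewrite -!sum_count !mulr_sumr -sumrB.
exact: (dot_out (fun i => (l%:R - #|W|%:R) * (mem W i)%:R
  - (#|W|%:R - k%:R) * (mem (~: W) i)%:R)).
Qed.

Lemma h_cycle s : uniq s -> (1 < size s)%N -> dot h (inc s) = (o \in s)%:R.
Proof.
move=> Us s1; rewrite (dot_out (fun i => (pred1 o i)%:R)) // sum_count.
by rewrite count_uniq_mem.
Qed.

Lemma count_memC s : (count (mem W) s + count (mem (~: W)) s)%N = size s.
Proof.
rewrite -(count_predC (mem W) s); congr addn.
by apply: eq_count => x; rewrite /= inE.
Qed.

Lemma cf_cycle_nat s : uniq s -> (1 < size s)%N ->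
  dot cf_coef (inc s) - cf_rhs =
  ((l - #|W|) * count (mem W) s)%:R
   - (k * (l - #|W|) + (#|W| - k) * count (mem (~: W)) s)%:R.
Proof.
move=> Us s1; rewrite cf_cycle // /cf_rhs natrD !natrM !natrB; [ring|lia|lia].
Qed.

Lemma cf_cycle_le s : uniq s -> (1 < size s)%N -> size s \in c ->
  dot cf_coef (inc s) <= cf_rhs.
Proof.
move=> Us s1 sc; rewrite -subr_le0 cf_cycle_nat // subr_le0 ler_nat.
have [] // := cardinality_forcing_nat kWl (count_le_card W Us) (b := count (mem (~: W)) s).
by rewrite count_memC gap.
Qed.

Lemma cf_cycle_eq s : uniq s -> (1 < size s)%N -> size s \in c ->
    dot cf_coef (inc s) = cf_rhs ->
  size s = k /\ {subset s <= W} \/ size s = l /\ {subset W <= s}.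
Proof.
move=> Us s1 sc /eqP; rewrite -subr_eq0 cf_cycle_nat // subr_eq0 eqr_nat => /eqP E.
have [|_ /(_ E)] := cardinality_forcing_nat kWl (count_le_card W Us)
    (b := count (mem (~: W)) s).
  by rewrite count_memC gap.
have sz := count_memC s.
case=> -[cW cO]; [left|right]; (split; first by rewrite -sz cW cO; lia) => x.
  move=> xs; apply/negPn/negP => xW; suff : (0 < count (mem (~: W)) s)%N by rewrite cO.
  by rewrite -has_count; apply/hasP; exists x; rewrite //= inE.
have sub : {subset [seq y <- s | y \in W] <= enum W}.
  by move=> y; rewrite mem_filter mem_enum => /andP[].
have [|_ E2] := uniq_min_size (filter_uniq _ Us) sub.
  by rewrite size_filter -cardE cW.
by move=> xW; have := E2 x; rewrite mem_enum xW mem_filter => /andP[].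
Qed.

Lemma cf_cycle_tight s : uniq s -> (1 < size s)%N ->
    size s = k /\ {subset s <= W} \/ size s = l /\ {subset W <= s} ->
  dot cf_coef (inc s) = cf_rhs.
Proof.
move=> Us s1 H; apply/eqP; rewrite -subr_eq0 cf_cycle_nat // subr_eq0 eqr_nat.
have sz := count_memC s; case: H => -[es sub].
  have cW : count (mem W) s = size s.
    by apply/eqP; rewrite -all_count; apply/allP => x /sub.
  have cO : count (mem (~: W)) s = 0%N by move: sz; rewrite cW -[RHS]addn0 => /addnI.
  by rewrite cW cO es muln0 addn0 mulnC.
have cW := count_superset Us sub.
have cO : count (mem (~: W)) s = (l - #|W|)%N by rewrite -es -sz cW addKn.
by rewrite cW cO -mulnDl mulnC; apply/eqP; congr muln; lia.
Qed.

Lemma dotD (g1 g2 : dart n -> R) x :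
  dot (fun e => g1 e + g2 e) x = dot g1 x + dot g2 x.
Proof. by rewrite /dot -big_split; apply: eq_bigr => e _; rewrite mulrDl. Qed.

Lemma PstarE x : Pstar hn c x <-> conv_hull (cycle_vector c) x /\ dot h x = 1.
Proof.
by rewrite /Pstar -arcsum_delta_out; split=> -[/PCE].
Qed.

Let X := cycle_vectors_at R c o.
Let Y := [seq x <- X | dot cf_coef x == cf_rhs].

Lemma Pstar_cycle s : uniq s -> (1 < size s)%N -> size s \in c -> o \in s ->
  Pstar hn c (inc s).
Proof.
move=> Us s1 sc os; apply/PstarE; rewrite h_cycle // os; split=> //.
by apply: conv_hull_point; exists s.
Qed.

Lemma mem_X_Pstar x : x \in X -> Pstar hn c x.
Proof. by case/mem_cycle_vectors_at => s [Us s1 sc os ->]; apply: Pstar_cycle. Qed.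

Lemma h_le1 x : cycle_vector c x -> dot h x <= 1.
Proof.
by case=> s [Us s1 sc ->]; rewrite h_cycle // lern1 leq_b1.
Qed.

Lemma Pstar_span x : Pstar hn c x -> x \in <<X>>%VS.
Proof.
case/PstarE; apply: (conv_hull_face (f := dot h)) => [|y [s [Us s1 sc ->]]].
  exact: h_le1.
rewrite /= h_cycle // => os; apply/memv_span/mem_cycle_vectors_at; exists s; split=> //.
by case: (o \in s) os => // /eqP; rewrite eq_sym oner_eq0.
Qed.

Lemma Pstar_le x : Pstar hn c x -> dot cf_coef x <= cf_rhs.
Proof.
case/PstarE => + _; apply: (conv_hull_le (f := dot cf_coef)).
by move=> y [s [Us s1 sc ->]]; apply: cf_cycle_le.
Qed.

(* The constraint [x(delta_out 1) <= 1] and the cardinality-forcing inequality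
   are both valid for every cycle, so tightness of their sum gives both. *)
Lemma face_span x : Pstar hn c x -> dot cf_coef x = cf_rhs -> x \in <<Y>>%VS.
Proof.
case/PstarE => Cx hx fx.
have : dot (fun e => h e + cf_coef e) x = 1 + cf_rhs by rewrite dotD hx fx.
apply: (conv_hull_face (f := dot (fun e => h e + cf_coef e))) Cx.
all: move=> y [s [Us s1 sc ->]] /=; rewrite dotD.
  by rewrite lerD ?cf_cycle_le // h_le1 //; exists s.
have hs : dot h (inc s) <= 1 by apply: h_le1; exists s.
have fs := cf_cycle_le Us s1 sc => e.
have {}hs : dot h (inc s) = 1 by lra.
have {}fs : dot cf_coef (inc s) = cf_rhs by lra.
apply: memv_span; rewrite mem_filter fs eqxx; apply/mem_cycle_vectors_at.
exists s; split=> //; move: hs; rewrite h_cycle //.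
by case: (o \in s) => // /eqP; rewrite eq_sym oner_eq0.
Qed.

(** A [k]-cycle through [o] and [u] is too short to be a tight [l]-cycle and does not stay inside
    [W]. Having [u] as its only outside node separates [u] from other outside nodes. *)
Lemma slack_cycle u : u \notin W ->
  exists s, [/\ uniq s, (1 < size s)%N, size s \in c & o \in s] /\
    [/\ u \in s, {subset s <= u |: W} & dot cf_coef (inc s) < cf_rhs].
Proof.
move=> uW; have ou : o != u by apply: contraNneq uW => <-.
have [||K /andP[sK Ks] cK] := @set_between _ [set o; u] (u |: W) k.
- by rewrite setUC setUS // sub1set.
- rewrite cards2 ou cardsU1 uW k2 add1n /=; case/andP: kWl => kW _.
  by apply: ltnW; apply: leq_trans kW _.
move: sK; rewrite subUset !sub1set => /andP[oK uK].
have Us := enum_uniq K; have sz : size (enum K) = k by rewrite -cardE.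
have s1 : (1 < size (enum K))%N by rewrite sz.
have sc : size (enum K) \in c by rewrite sz.
exists (enum K); split; split; rewrite ?mem_enum //.
  by move=> x; rewrite mem_enum => /(subsetP Ks).
rewrite lt_neqAle cf_cycle_le // andbT; apply/eqP => /(cf_cycle_eq Us s1 sc).
case=> [[_ /(_ u)]|[+ _]]; first by rewrite mem_enum uK (negbTE uW) => /(_ isT).
by rewrite sz => kl; case/andP: kWl; rewrite kl => /ltn_trans lW /lW; rewrite ltnn.
Qed.

(** * Necessity: further equations satisfied by the face *)

Lemma face_vanish (g : dart n -> R) :
    (forall s, uniq s -> (1 < size s)%N ->
      size s = k /\ {subset s <= W} \/ size s = l /\ {subset W <= s} ->
      dot g (inc s) = 0) ->
  forall x, Pstar hn c x -> dot cf_coef x = cf_rhs -> dot g x = 0.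
Proof.
move=> gT x Px fx; have := face_span Px fx.
move=> /(scalar_span (f := dot g) (h := dot h) (b := 0)) ->; first by rewrite mul0r.
move=> y; rewrite mem_filter => /andP[/eqP fy /mem_cycle_vectors_at[s [Us s1 sc os ey]]].
by rewrite mul0r ey /= gT //; apply: cf_cycle_eq; rewrite -?ey.
Qed.

Lemma two_outside : (#|W| + 2 <= n)%N ->
  exists u v, [/\ u \notin W, v \notin W & u != v].
Proof.
move=> W2; have : (1 < #|~: W|)%N by have := cardsC W; rewrite card_ord; lia.
by case/card_gt1P => u [v [+ + uv]]; rewrite !inE => uW vW; exists u, v.
Qed.

(** A tight [l]-cycle has one node outside [W] and a tight [k]-cycle none, so no tight cycle uses an
    arc between two outside nodes; [g] is the coordinate of such an arc. *)
Lemma not_facet_succ : l = #|W|.+1 -> (l < n)%N ->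
  ~ defines_facet (Pstar hn c) (dot cf_coef) cf_rhs.
Proof.
move=> lW ltn; have [|u [v [uW vW uv]]] := two_outside; first by lia.
pose e0 : dart n := exist (fun e : 'I_n * 'I_n => e.1 != e.2) (u, v) uv.
pose g (e : dart n) : R := (e == e0)%:R.
have gE s : dot g (inc s) = ((u \in s) && (next s u == v))%:R.
  rewrite /dot (bigD1 e0) //= /g eqxx mul1r big1 => [|e /negbTE ->]; last by rewrite mul0r.
  by rewrite addr0 ffunE inE.
have [s [[Us s1 sc os] [us sub fs]]] := slack_cycle uW.
have uo : o != u by apply: contraNneq uW => <-.
have vo : o != v by apply: contraNneq vW => <-.
have [||K /andP[sK _] cK] := @set_between _ [set o; u; v] setT l.
- exact: subsetT.
- rewrite cardsT card_ord ln andbT; have [le3 _] := leq_card_setU [set o; u] [set v].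
  by apply: leq_trans le3 _; rewrite cards1 cards2 uo ltnW // l_gt3.
(* Starting with [u], [v] makes the tour use the arc [e0], so [g] is 1 there, whereas [s] avoids
   [v]. *)
pose t := [:: u, v & enum (K :\: [set u; v])].
have Ut : uniq t.
  by rewrite /= inE !mem_enum !inE !eqxx !orbT /= (negbTE uv) enum_uniq.
have st : size t = l.
  have uvK : [set u; v] \subset K by apply: subset_trans sK; rewrite -setUA subsetUr.
  by rewrite /= -cardE (cardsDS uvK) cK cards2 uv /= -addn2 subnK // ltnW // ltnW // l_gt3.
have ot : o \in t.
  rewrite !inE mem_enum !inE (negbTE uo) (negbTE vo) /=.
  by apply: (subsetP sK); rewrite !inE eqxx.
apply: (not_facet (g := dot g) (y := inc s) (z := inc t)).
- apply: face_vanish => s' Us' s'1 T; rewrite gE.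
  case: (boolP (u \in s')) => //= us'; case: eqP => //= nv.
  have vs' : v \in s' by rewrite -nv mem_next.
  case: T => [[_ /(_ _ us')]|[sz sW]]; first by rewrite (negbTE uW).
  have := count_memC s'; rewrite (count_superset Us' sW) sz lW -addn1 => /addnI cO.
  suff : (2 <= count (mem (~: W)) s')%N by rewrite cO.
  rewrite -size_filter; apply: (@uniq_leq_size _ [:: u; v]); first by rewrite /= inE uv.
  move=> x; rewrite !inE mem_filter => /orP[]/eqP->; rewrite /= inE ?uW ?vW //.
- exact: Pstar_cycle.
- by apply: Pstar_cycle; rewrite ?st // (ltn_trans _ l_gt3).
- have gt : dot g (inc t) = 1 by rewrite gE /= inE !eqxx.
  rewrite /= gt gE mulr1; have -> : (next s u == v) = false.
    apply/negbTE/eqP => nv; have := sub v; rewrite -nv mem_next us nv !inE.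
    by rewrite (negbTE vW) eq_sym (negbTE uv) => /(_ isT).
  by rewrite andbF mulr0 subr_eq0 lt_eqF.
Qed.

(** A tight cycle is Hamiltonian or stays inside [W], so it visits both of [u], [v] or neither. *)
Lemma not_facet_hamiltonian : l = n -> (#|W| + 2 <= n)%N ->
  ~ defines_facet (Pstar hn c) (dot cf_coef) cf_rhs.
Proof.
move=> eln W2; have [u [v [uW vW uv]]] := two_outside W2.
pose g (e : dart n) : R := (pred1 u (val e).1)%:R - (pred1 v (val e).1)%:R.
have gE s : uniq s -> (1 < size s)%N -> dot g (inc s) = (u \in s)%:R - (v \in s)%:R.
  move=> Us s1; rewrite (dot_out (fun i => (pred1 u i)%:R - (pred1 v i)%:R)) //.
  by rewrite sumrB !sum_count !count_uniq_mem.
have [s [[Us s1 sc os] [us ss fs]]] := slack_cycle uW.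
have [t [[Ut t1 tc ot] [vt tt ft]]] := slack_cycle vW.
have vs : (v \in s) = false.
  by apply/negbTE/negP => /ss; rewrite !inE (negbTE vW) eq_sym (negbTE uv).
have ut : (u \in t) = false.
  by apply/negbTE/negP => /tt; rewrite !inE (negbTE uW) (negbTE uv).
apply: (not_facet (g := dot g) (y := inc s) (z := inc t)).
- apply: face_vanish => s' Us' s'1 [[_ sW]|[sz _]]; rewrite gE //.
    have -> : (u \in s') = false by apply: contraNF uW => /sW.
    have -> : (v \in s') = false by apply: contraNF vW => /sW.
    by rewrite subrr.
  have full x : x \in s'.
    have [||_ ->] := @uniq_min_size _ s' (enum 'I_n) Us'; rewrite ?mem_enum //.
      by move=> y _; rewrite mem_enum.
    by rewrite size_enum_ord sz eln.
  by rewrite !full subrr.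
- exact: Pstar_cycle.
- exact: Pstar_cycle.
(* Both cycles are strictly below the bound while [g] is 1 and -1 on them, so the two products have
   opposite signs. *)
- rewrite /= !gE // us vs ut vt sub0r subr0 mulrN1 mulr1 gt_eqF //.
  by rewrite (@lt_trans _ _ 0) ?oppr_gt0 ?subr_lt0.
Qed.

(** One slack cycle [s] and the tight cycles through [o] span all cycles through [o]: a functional
    vanishing on the tight ones is a multiple of the slack, and [s] kills the multiplier. *)
Lemma cf_facet :
    ((2 <= l - #|W|)%N /\ (l < n)%N) \/ (l = n /\ #|W| = n.-1) ->
  defines_facet (Pstar hn c) (dot cf_coef) cf_rhs.
Proof.
move=> lW.
have [u uW] : exists i, i \notin W.
  have : (0 < #|~: W|)%N by have := cardsC W; rewrite card_ord; lia.
  by case/card_gt0P => u; rewrite inE; exists u.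
have [s [[Us s1 sc os] [us ss fs]]] := slack_cycle uW.
apply: (facet_of_spans (h := dot h) (X := X) (Y := Y) (y := inc s)).
- by move=> x /PstarE[].
- exact: Pstar_le.
- exact: mem_X_Pstar.
- exact: Pstar_span.
- by move=> x; rewrite mem_filter => /andP[/eqP fx /mem_X_Pstar].
- exact: face_span.
- exact: Pstar_cycle.
- by rewrite lt_eqF.
move=> x /mem_cycle_vectors_at[t [Ut t1 tc ot ->]]; apply: mem_span_dot => g gY.
have gT t' : uniq t' -> (1 < size t')%N -> o \in t' ->
    size t' = k /\ {subset t' <= W} \/ size t' = l /\ {subset W <= t'} ->
    dot g (inc t') = 0.
  move=> Ut' t'1 ot' T; apply: gY; rewrite inE mem_filter cf_cycle_tight // eqxx.
  apply/orP; right; apply/mem_cycle_vectors_at; exists t'; split=> //.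
  by case: T => -[-> _].
have [||||A HA] := @tight_functional R n g W o k l hn oW _ _ lW.
- by rewrite k2; case/andP: kWl.
- by rewrite ln andbT; case/andP: kWl.
- by move=> t' Ut' st' ot' t'W; apply: gT => //; [rewrite st'|left].
- move=> t' Ut' st' Wt'; apply: gT => //; [|exact: Wt'|by right].
  by rewrite st' (ltn_trans _ l_gt3).
have A0 : A = 0.
  have := HA s Us s1 os; rewrite gY ?inE ?eqxx // mulr0 -cf_cycle // -/cf_rhs => /esym/eqP.
  by rewrite mulf_eq0 subr_eq0 (lt_eqF fs) orbF => /eqP.
have := HA t Ut t1 ot; rewrite A0 mul0r => /eqP; rewrite mulf_eq0 subr_eq0 eqr_nat.
by case/orP=> [/eqP lE|/eqP//]; case/andP: kWl; rewrite lE ltnn.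
Qed.

End CardinalityForcing.

Theorem theorem6 (R : realFieldType) (n : nat) (hn : (4 <= n)%N)
    (c : seq nat) (hc : cardinality_sequence n c)
    (p : nat) (hp : (1 <= p <= (size c).-1)%N)
    (hcp : (2 <= card_at c p)%N)
    (W : {set 'I_n}) (h1W : node1 hn \in W)
    (hW : (card_at c p < #|W| < card_at c p.+1)%N) :
  defines_facet (Pstar (R := R) hn c)
    (fun x : arcvec R n =>
       ((card_at c p.+1)%:R - #|W|%:R)
         * (\sum_(i in W) arcsum x (delta_out i))
       - (#|W|%:R - (card_at c p)%:R)
         * (\sum_(i in ~: W) arcsum x (delta_out i)))
    ((card_at c p)%:R * ((card_at c p.+1)%:R - #|W|%:R))
  <->
  ((2 <= card_at c p.+1 - #|W|)%N /\ (card_at c p.+1 < n)%N)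
  \/ (card_at c p.+1 = n /\ #|W| = n.-1).
Proof.
set k := card_at c p; set l := card_at c p.+1.
have [pc0 pc] : (p.-1 < size c)%N /\ (p.-1.+1 < size c)%N by lia.
have kc : k \in c by apply: mem_nth.
have lE : l = nth 0%N c p.-1.+1 by rewrite /l /card_at /=; congr nth; lia.
have lc : l \in c by rewrite lE; apply: mem_nth.
case/andP: hc => sc /allP /(_ _ lc) /andP[_ ln].
have gap m : m \in c -> (m <= k)%N || (l <= m)%N.
  by rewrite lE; apply: sorted_ltn_gap.
apply: (iff_trans (defines_facet_ext _ _ (cf_coefE k l W))).
split; last exact: cf_facet.
(* When the condition fails, [l < n] leaves [l = #|W| + 1], and [l = n] leaves at least two nodes
   outside [W]. *)
have [ltn|gen] := ltnP l n.
  have [lW|lW] := leqP 2 (l - #|W|); first by left.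
  by move/(not_facet_succ kc lc gap hcp hW ln h1W)=> H; exfalso; apply: H => //; lia.
have eln : l = n by lia.
have [W2|W2] := leqP (#|W| + 2) n; last by right; lia.
by move/(not_facet_hamiltonian kc lc gap hcp hW ln h1W eln W2).
Qed.
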